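(* Choose (with replacement) $\alpha+\beta$ indices from the set $\{1,\dots,L\}$, and denote them $i_1,\dots,i_\alpha,j_1,\dots,j_\beta$. Let $X_\ell\sim\mathcal{N}(m_\ell,C_\ell)$ ($1\le\ell\le L$) be Gaussian random variables in $\mathbb{R}^d$ with densities $\phi_\ell$. Let $Z$ and $X$ denote respectively the normalization constant and the Gaussian random variable corresponding to the product $\left(\prod_{a=1}^\alpha\phi_{i_a}\right)\left(\prod_{b=1}^\beta\phi_{j_b}\right)$, i.e. this product equals $Z\Phi$ with $\Phi$ the density of $X\sim\mathcal{N}(m,C)$, and let $M^k=\mathbb{E}(X^{\otimes k})$ denote the $k$-th tensor moment of $X$. Then $$I^{\alpha,\beta}_{i_1,\dots,i_\alpha;j_1,\dots,j_\beta}:=\int_{\mathbb{R}^d}\left(\prod_{a=1}^\alpha\phi_{i_a}(x)\right)\left(\bigotimes_{b=1}^\beta\nabla\phi_{j_b}(x)\right)dx = Z\sum_{J\subseteq\{1,\dots,\beta\}}(-1)^{\beta-|J|}\left(\bigotimes_{b=1}^\beta C_{j_b}^{-1}\right)\times_E\left(\left(\bigotimes_{b\in J}m_{j_b}\right)\otimes M^{\beta-|J|}\right)_{\sigma_J},$$ where the factors in $\bigotimes_{b\in J}$ are taken in ascending order of $b$, and $\sigma_J$ is the unique permutation of the $\beta$ tensor modes that maps the first $|J|$ modes to the positions in $J$ and the remaining modes to the positions in $\{1,\dots,\beta\}\setminus J$, in ascending order. Moreover, when $(y_k)_{k=1}^N\subset\mathbb{R}^d$ and $(\omega_k)_{k=1}^N$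 are $N\ge1$ Gauss–Hermite quadrature nodes and weights, respectively, for polynomials of degree $\beta$, this expression reduces to $$I^{\alpha,\beta}_{i_1,\dots,i_\alpha;j_1,\dots,j_\beta}=Z\,\pi^{-\frac d2}\sum_{k=1}^N\omega_k\left(\bigotimes_{b=1}^\beta C_{j_b}^{-1}\left(m_{j_b}-\left(\sqrt2\,C^{\frac12}y_k+m\right)\right)\right),$$ where $C^{\frac12}$ is the Cholesky factor of the covariance matrix $C$ of $X$.
   Context: $\mathcal{N}(m_\ell,C_\ell)$ has mean $m_\ell\in\mathbb{R}^d$, symmetric positive definite covariance $C_\ell\in\mathbb{R}^{d\times d}$, and density $\phi_\ell(x)=(2\pi)^{-d/2}(\det C_\ell)^{-1/2}\exp(-\frac12(x-m_\ell)^\top C_\ell^{-1}(x-m_\ell))$. A finite product of such densities is a positive constant (the normalization constant) times a Gaussian density. $x^{\otimes k}$ is the outer (tensor) product of $x$ with itself $k$ times. Even-mode tensor contraction: for a tensor $A$ with dimensions $[n_1,n_2,\dots,n_{2p}]$ and a tensor $B$ with dimensions $[n_2,n_4,\dots,n_{2p}]$, $A\times_EB$ is the tensor with dimensions $[n_1,n_3,\dots,n_{2p-1}]$ given by $(A\times_EB)_{i_1,i_3,\dots,i_{2p-1}}=\sum_{i_2,i_4,\dots,i_{2p}}A_{i_1,i_2,\dots,i_{2p}}B_{i_2,i_4,\dots,i_{2p}}$. Gauss–Hermite nodes and weights for polynomials of degree $\beta$ are such that $\int_{\mathbb{R}^d}e^{-x^\top x}p(x)\,dx=\sum_{k=1}^N\omega_kp(y_k)$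 for every polynomial $p$ on $\mathbb{R}^d$ of degree at most $\beta$. The Cholesky factor satisfies $C=C^{1/2}(C^{1/2})^\top$. *)

(* Defs.v *)
From HB Require Import structures.
From mathcomp Require Import all_boot all_order all_algebra all_fingroup.
From mathcomp Require Import all_classical all_reals all_analysis.
From mathcomp Require mpoly.
Import (canonicals, coercions) mpoly.

Set Implicit Arguments.
Unset Strict Implicit.
Unset Printing Implicit Defensive.

Import Order.TTheory GRing.Theory Num.Theory.
Import numFieldNormedType.Exports.

Local Open Scope classical_set_scope.
Local Open Scope ring_scope.

(* Column vectors carry the sigma-algebra generated by the coordinates; for   *)
(* 'cV[R]_n this is the Borel sigma-algebra of R^n.                           *)
Definition measure_col_display : measure_display -> measure_display.
Proof. exact. Qed.

Section measurable_col.
Context {disp : measure_display} {T : measurableType disp} (n : nat).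

Let coords : 'I_n -> 'cV[T]_n -> T := fun i x => x i 0.

Let col_set0 : g_sigma_preimage coords set0.
Proof. exact: sigma_algebra0. Qed.

Let col_setC A : g_sigma_preimage coords A -> g_sigma_preimage coords (~` A).
Proof. exact: sigma_algebraC. Qed.

Let col_bigcup (F : _^nat) : (forall i, g_sigma_preimage coords (F i)) ->
  g_sigma_preimage coords (\bigcup_i (F i)).
Proof. exact: sigma_algebra_bigcup. Qed.

HB.instance Definition _ := @isMeasurable.Build (measure_col_display disp)
  'cV[T]_n (g_sigma_preimage coords) col_set0 col_setC col_bigcup.

End measurable_col.

Lemma measurable_coord disp (T : measurableType disp) n (i : 'I_n) :
  measurable_fun [set: 'cV[T]_n] (fun x : 'cV[T]_n => x i 0).
Proof.
move=> _ Y mY; rewrite setTI; apply: sub_sigma_algebra => /=.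
rewrite -bigcup_seq/=; exists i => /=; first by rewrite mem_index_enum.
by exists Y => //; rewrite setTI.
Qed.

Lemma measurable_fun_colP d1 d2 (T1 : measurableType d1)
    (T2 : measurableType d2) n (f : T1 -> 'cV[T2]_n) :
  measurable_fun [set: T1] f <->
  forall i, measurable_fun [set: T1] (fun t => f t i 0).
Proof.
split=> [mf i|mf].
  exact: (measurableT_comp (measurable_coord i) mf).
move=> _ A mA; rewrite setTI; move: A mA.
have : g_sigma_preimage (fun (i : 'I_n) (x : 'cV[T2]_n) => x i 0) `<=`
    [set A | measurable (f @^-1` A)].
  apply: smallest_sub; first split => /=.
  - by rewrite preimage_set0; exact: measurable0.
  - by move=> A mA; rewrite setTD preimage_setC; exact: measurableC.
  - by move=> F mF; rewrite preimage_bigcup; exact: bigcup_measurable.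
  move=> A; rewrite -bigcup_seq/= => -[i _ [B mB <-]] /=.
  by rewrite setTI -[X in measurable X]setTI; exact: (mf i).
exact.
Qed.

Section lebesgue_measure_col.
Context {R : realType}.

Definition ccons n (p : measurableTypeR R * 'cV[R]_n) : 'cV[R]_n.+1 :=
  col_mx p.1%:M p.2.

Lemma ccons0 n (p : measurableTypeR R * 'cV[R]_n) : ccons p ord0 0 = p.1.
Proof.
have -> : ord0 = lshift n (ord0 : 'I_1) :> 'I_(1 + n) by exact: val_inj.
by rewrite /ccons (@col_mxEu _ 1) mxE eqxx mulr1n.
Qed.

Lemma cconsS n (p : measurableTypeR R * 'cV[R]_n) (i : 'I_n) :
  ccons p (lift ord0 i) 0 = p.2 i 0.
Proof.
have -> : lift ord0 i = rshift 1 i :> 'I_(1 + n) by exact: val_inj.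
by rewrite /ccons (@col_mxEd _ 1).
Qed.

Lemma measurable_ccons n :
  measurable_fun [set: measurableTypeR R * 'cV[R]_n] (@ccons n).
Proof.
apply/measurable_fun_colP => i.
have [j ->|->] := fintype.unliftP ord0 i; last first.
- under eq_fun do rewrite ccons0.
  exact: measurable_fst.
- under eq_fun do rewrite cconsS.
  exact: (measurableT_comp (measurable_coord j) measurable_snd).
Qed.

HB.instance Definition _ n := isMeasurableFun.Build _ _ _ _ (@ccons n)
  (@measurable_ccons n).

Let cuncons n (x : 'cV[R]_n.+1) : measurableTypeR R * 'cV[R]_n :=
  (x ord0 0, \col_i x (lift ord0 i) 0).

Let cconsK n : cancel (@ccons n) (@cuncons n).
Proof.
move=> p; rewrite /cuncons ccons0 [RHS]surjective_pairing; congr pair.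
by apply/colP => i; rewrite mxE cconsS.
Qed.

Let measurable_cuncons n : measurable_fun [set: 'cV[R]_n.+1] (@cuncons n).
Proof.
apply: measurable_fun_pair; first exact: measurable_coord.
apply/measurable_fun_colP => i.
by under eq_fun do rewrite mxE; exact: measurable_coord.
Qed.

Section step.
Context n (mu : {sigma_finite_measure set 'cV[R]_n -> \bar R}).

(* Lebesgue measure on R^(n+1), as the product of Lebesgue measure on R with  *)
(* mu on R^n; lebesgue_col_box below gives the volume of boxes.               *)
Definition lebesgue_step : set 'cV[R]_n.+1 -> \bar R :=
  pushforward (@lebesgue_measure R \x mu)%E (@ccons n).

Let lebesgue_step0 : lebesgue_step set0 = 0%E.
Proof. by rewrite /lebesgue_step /pushforward preimage_set0 measure0. Qed.

Let lebesgue_step_ge0 A : (0 <= lebesgue_step A)%E.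
Proof. exact: measure_ge0. Qed.

Let lebesgue_step_sigma_additive : semi_sigma_additive lebesgue_step.
Proof.
exact: (@measure_semi_sigma_additive _ _ _ (pushforward _ (@ccons n))).
Qed.

HB.instance Definition _ := isMeasure.Build _ _ _ lebesgue_step
  lebesgue_step0 lebesgue_step_ge0 lebesgue_step_sigma_additive.

Let lebesgue_step_sigma_finite : sigma_finite setT lebesgue_step.
Proof.
have /sigma_finiteP[F [TF ndF Foo]] := sigma_finiteT (@lebesgue_measure R).
have /sigma_finiteP[G [TG ndG Goo]] := sigma_finiteT mu.
exists (fun k => @cuncons n @^-1` (F k `*` G k)) => [|k].
  apply/seteqP; split=> // x _.
  have [i _ Fx] : (\bigcup_i F i) (cuncons x).1 by rewrite -TF.
  have [j _ Gx] : (\bigcup_j G j) (cuncons x).2 by rewrite -TG.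
  exists (maxn i j) => //; split.
  - by move: Fx; exact/subsetPset/ndF/leq_maxl.
  - by move: Gx; exact/subsetPset/ndG/leq_maxr.
have [mF Fk] := Foo k; have [mG Gk] := Goo k; split.
  rewrite -[X in measurable X]setTI; apply: measurable_cuncons => //.
  exact: measurableX.
rewrite /lebesgue_step /pushforward (_ : _ @^-1` _ = F k `*` G k).
  by rewrite product_measure1E// lte_mul_pinfty// ge0_fin_numE.
rewrite -comp_preimage (_ : @cuncons n \o @ccons n = id) ?preimage_id//.
exact/funext/cconsK.
Qed.

HB.instance Definition _ := @Measure_isSigmaFinite.Build _ _ _ lebesgue_step
  lebesgue_step_sigma_finite.

End step.

Fixpoint lebesgue_col (n : nat) :
    {sigma_finite_measure set 'cV[R]_n -> \bar R} :=
  match n with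
  | 0 => \d_(0 : 'cV[R]_0)
  | n'.+1 => lebesgue_step (lebesgue_col n')
  end.

Lemma measurable_box n (B : 'I_n -> set R) :
  (forall i, measurable (B i)) ->
  measurable [set x : 'cV[R]_n | forall i, B i (x i 0)].
Proof.
move=> mB; rewrite (_ : [set x | _] =
    \big[setI/setT]_(i <- enum 'I_n) [set x : 'cV[R]_n | B i (x i 0)]).
  apply: bigsetI_measurable => i _.
  by rewrite -[X in measurable X]setTI; exact: measurable_coord.
rewrite -bigcap_seq; apply/seteqP; split => x /= Bx i.
  by move=> _; exact: Bx.
by apply: Bx => /=; rewrite mem_enum.
Qed.

Lemma lebesgue_col_box n (B : 'I_n -> set R) :
  (forall i, measurable (B i)) ->
  lebesgue_col n [set x | forall i, B i (x i 0)] =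
  (\prod_(i < n) @lebesgue_measure R (B i))%E.
Proof.
elim: n B => [|n IHn] B mB.
  rewrite big_ord0 /= diracE mem_set//= => i.
  by case: i.
rewrite big_ord_recl -IHn//= /lebesgue_step /pushforward.
rewrite -product_measure1E; [|exact: mB|
  exact: (@measurable_box _ (fun i => B (lift ord0 i)) (fun=> mB _))].
congr (_ _); apply/seteqP; split=> [p /= Bp|p /= [B0 Bp] i].
- by split=> [|i]; [have := Bp ord0; rewrite ccons0|
    have := Bp (lift ord0 i); rewrite cconsS].
- by have [j ->|->] := fintype.unliftP ord0 i; rewrite ?cconsS ?ccons0.
Qed.

End lebesgue_measure_col.

Section tensors.
Context (R : realType) (d : nat).

(* A i is the entry of the order-k tensor A at the multi-index i; every mode  *)
(* has dimension d.                                                           *)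
Definition tensor (k : nat) := {ffun {ffun 'I_k -> 'I_d} -> R}.

Definition tensor_cast k l (e : k = l) (A : tensor k) : tensor l :=
  [ffun i : {ffun 'I_l -> 'I_d} => A [ffun a => i (cast_ord e a)]].

Definition tensor_mul k l (A : tensor k) (B : tensor l) : tensor (k + l) :=
  [ffun i : {ffun 'I_(k + l) -> 'I_d} =>
    A [ffun a => i (lshift l a)] * B [ffun b => i (rshift k b)]].

Definition tensor_vec k (v : 'I_k -> 'cV[R]_d) : tensor k :=
  [ffun i : {ffun 'I_k -> 'I_d} => \prod_(a < k) v a (i a) 0].

Definition tensor_pow (x : 'cV[R]_d) k : tensor k := tensor_vec (fun=> x).

(* Parity refers to modes counted from 1: the odd modes are at the 0-based     *)
(* positions 2b, the even ones at 2b+1.                                       *)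
Lemma odd_mode_subproof p (b : 'I_p) : (b.*2 < p.*2)%N.
Proof. by rewrite ltn_double. Qed.

Lemma even_mode_subproof p (b : 'I_p) : (b.*2.+1 < p.*2)%N.
Proof. by rewrite ltn_Sdouble. Qed.

Definition odd_mode p (b : 'I_p) : 'I_p.*2 := Ordinal (odd_mode_subproof b).
Definition even_mode p (b : 'I_p) : 'I_p.*2 := Ordinal (even_mode_subproof b).

Lemma half_mode_subproof p (k : 'I_p.*2) : (k./2 < p)%N.
Proof. by rewrite ltn_half_double. Qed.

Definition half_mode p (k : 'I_p.*2) : 'I_p := Ordinal (half_mode_subproof k).

Definition interleave p (i l : {ffun 'I_p -> 'I_d}) : {ffun 'I_p.*2 -> 'I_d} :=
  [ffun k : 'I_p.*2 => (if odd k then l else i) (half_mode k)].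

Lemma interleave_odd p (i l : {ffun 'I_p -> 'I_d}) b :
  interleave i l (odd_mode b) = i b.
Proof.
rewrite ffunE /= odd_double; congr (i _).
by apply: val_inj => /=; rewrite doubleK.
Qed.

Lemma interleave_even p (i l : {ffun 'I_p -> 'I_d}) b :
  interleave i l (even_mode b) = l b.
Proof.
rewrite ffunE /= odd_double; congr (l _).
by apply: val_inj => /=; rewrite uphalf_double.
Qed.

Definition tensor_mx k (A : 'I_k -> 'M[R]_d) : tensor k.*2 :=
  [ffun i : {ffun 'I_k.*2 -> 'I_d} =>
    \prod_(b < k) A b (i (odd_mode b)) (i (even_mode b))].

(* interleave i l is the multi-index (i_1, l_1, i_2, l_2, ..., i_p, l_p).     *)
Definition contract_even p (A : tensor p.*2) (B : tensor p) : tensor p :=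
  [ffun i => \sum_(l : {ffun 'I_p -> 'I_d}) A (interleave i l) * B l].

(* Mode a of A becomes mode s a of the result.                                *)
Definition perm_modes k (s : 'S_k) (A : tensor k) : tensor k :=
  [ffun i : {ffun 'I_k -> 'I_d} => A [ffun a => i (s a)]].

End tensors.

Section sigma.
Context {k : nat} (J : {set 'I_k}).

Lemma card_modes : (#|J| + (k - #|J|))%N = k.
Proof. by rewrite subnKC// -[leqRHS]card_ord max_card. Qed.

Lemma size_sigma_seq : size (enum J ++ enum (~: J)) == k.
Proof. by rewrite size_cat -!cardE cardsC card_ord. Qed.

Let sigma_fun (a : 'I_k) : 'I_k := tnth (Tuple size_sigma_seq) a.

Let sigma_fun_nth x (a : 'I_k) : sigma_fun a =
  if (a < #|J|)%N then nth x (enum J) a else nth x (enum (~: J)) (a - #|J|).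
Proof. by rewrite /sigma_fun (tnth_nth x)/= nth_cat -cardE. Qed.

Lemma sigma_fun_inj : injective sigma_fun.
Proof.
apply/tuple_uniqP; rewrite /= cat_uniq !enum_uniq/= andbT.
by apply/hasPn => a; rewrite /= !mem_enum inE.
Qed.

(* By the next two lemmas, sigma_modes J sends the first #|J| modes to J and  *)
(* the others to ~: J, increasingly in both cases.                            *)
Definition sigma_modes : 'S_k := perm sigma_fun_inj.

Lemma sigma_modes_in (a : 'I_k) : (sigma_modes a \in J) = (a < #|J|)%N.
Proof.
rewrite permE (sigma_fun_nth a); case: ltnP => aJ.
  by rewrite -mem_enum mem_nth// -cardE.
apply/negbTE; set x := nth _ _ _.
suff : x \in ~: J by rewrite inE.
rewrite -mem_enum mem_nth// -cardE.
by rewrite -(ltn_add2l #|J|) subnKC// cardsC card_ord.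
Qed.

Lemma sigma_modes_mono (a b : 'I_k) :
  (a < #|J|)%N = (b < #|J|)%N -> (a < b)%N -> (sigma_modes a < sigma_modes b)%N.
Proof.
have srt (S : {set 'I_k}) : sorted (fun x y : 'I_k => (x < y)%N) (enum S).
  rewrite {1}/enum_mem -enumT; apply: sorted_filter.
    by move=> x y z; exact: ltn_trans.
  by have := iota_ltn_sorted 0 k; rewrite -val_enum_ord sorted_map.
have tr : transitive (fun x y : 'I_k => (x < y)%N).
  by move=> x y z; exact: ltn_trans.
rewrite !permE !(sigma_fun_nth a) => e ab; rewrite -e.
case: ltnP e => aJ /esym bJ.
- by apply: (sorted_ltn_nth tr) => //; rewrite inE -cardE.
- have Jb : (#|J| <= b)%N by exact: leq_trans aJ (ltnW ab).
  have sz (c : 'I_k) : (#|J| <= c)%N -> (c - #|J| < #|~: J|)%N.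
    by move=> Jc; rewrite -(ltn_add2l #|J|) subnKC// cardsC card_ord.
  apply: (sorted_ltn_nth tr) => //; rewrite ?inE -?cardE ?sz//.
  by rewrite ltn_sub2r// (leq_ltn_trans aJ).
Qed.

End sigma.

Section gaussian.
Context {R : realType} {d : nat}.

Definition spd (C : 'M[R]_d) : Prop :=
  C^T = C /\ forall x : 'cV[R]_d, x != 0 -> 0 < (x^T *m C *m x) 0 0.

Definition gauss_pdf (m : 'cV[R]_d) (C : 'M[R]_d) (x : 'cV[R]_d) : R :=
  (2 * pi) `^ (- (d%:R / 2)) * (\det C) `^ (- 2^-1) *
  expR (- 2^-1 * ((x - m)^T *m invmx C *m (x - m)) 0 0).

(* X ~ N(m, C), for a symmetric positive definite C. *)
Definition gaussian_rv (disp : measure_display) (Omega : measurableType disp)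
    (P : probability Omega R) (X : {RV P >-> 'cV[R]_d})
    (m : 'cV[R]_d) (C : 'M[R]_d) : Prop :=
  forall A : set 'cV[R]_d, measurable A ->
    (distribution P X A = \int[lebesgue_col d]_(x in A) (gauss_pdf m C x)%:E)%E.

Definition grad (f : 'cV[R]_d -> R) (x : 'cV[R]_d) : 'cV[R]_d :=
  \col_a 'D_(delta_mx a 0) f x.

Definition tensor_integral k (F : 'cV[R]_d -> tensor R d k) : tensor R d k :=
  [ffun i => \int[lebesgue_col d]_x F x i].

Definition tensor_moment (disp : measure_display) (Omega : measurableType disp)
    (P : probability Omega R) (X : {RV P >-> 'cV[R]_d}) (k : nat) :
    tensor R d k :=
  [ffun i => fine ('E_P[fun w => tensor_pow (X w) k i])%E].

(* I^{alpha,beta}_{i_1,...,i_alpha; j_1,...,j_beta} *)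
Definition gauss_grad_integral L (m_ : 'I_L -> 'cV[R]_d) (C_ : 'I_L -> 'M[R]_d)
    alpha beta (i : 'I_alpha -> 'I_L) (j : 'I_beta -> 'I_L) :
    tensor R d beta :=
  tensor_integral (fun x =>
    (\prod_(a < alpha) gauss_pdf (m_ (i a)) (C_ (i a)) x) *:
    tensor_vec (fun b => grad (gauss_pdf (m_ (j b)) (C_ (j b))) x)).

Definition cholesky_factor (A C : 'M[R]_d) : Prop :=
  [/\ is_trig_mx A, forall a, 0 < A a a & A *m A^T = C].

(* [mpoly.msize p] is the total degree of [p] plus one (0 for [p = 0]). *)
Definition gauss_hermite (beta N : nat) (y : 'I_N -> 'cV[R]_d)
    (w : 'I_N -> R) : Prop :=
  forall p : mpoly.mpoly d R, (mpoly.msize p <= beta.+1)%N ->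
    \int[lebesgue_col d]_x
      (expR (- (x^T *m x) 0 0) * mpoly.meval (fun a => x a 0) p) =
    \sum_(k < N) w k * mpoly.meval (fun a => y k a 0) p.

End gaussian.

(* Main.v *)
Require Import Defs.
From HB Require Import structures.
From mathcomp Require Import all_boot all_order all_algebra all_fingroup.
From mathcomp Require Import all_classical all_reals all_analysis.
From mathcomp Require Import measurable_realfun ring lra.
From mathcomp Require mpoly.
Import (canonicals, coercions) mpoly.

Set Implicit Arguments.
Unset Strict Implicit.
Unset Printing Implicit Defensive.

Import Order.TTheory GRing.Theory Num.Theory.
Import numFieldNormedType.Exports.

Local Open Scope classical_set_scope.
Local Open Scope ring_scope.

(** Differentiating a Gaussian density multiplies it by an affine vector
    field: the gradient of phi_j is phi_j(x) C_j^-1 (m_j - x)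
    ([grad_gauss_pdf]). Each entry of the integrand is therefore the full
    product of densities, that is Z Phi(x), times a product of beta affine
    forms, one for each tensor mode ([gauss_grad_integralE]). Both formulas
    evaluate the integral of Phi against such a product.

    For the moment formula, expand the product over b of C_jb^-1 (m_jb - x):
    the set J collects the modes in which m_jb was chosen rather than - x
    ([prod_mulmx_subr]), and the integral of Phi times a monomial is an entry
    of a tensor moment of X ([expectation_gaussian_rv]). Exchanging the sum
    and the integral needs every monomial to be integrable against Phi.
    As |t| <= e^t + e^-t, a product of affine forms is dominated by a
    combination of finitely many exponentials e^(v.x), and completing the
    square makes e^(v.x) Phi(x) a constant multiple of the translate
    Phi(x - C v) ([gauss_pdf_tilt]). Translation invariance then
    reduces the claim to the integrability of Phi itself, which holds because
    X has density Phi.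

    For the quadrature formula, substitute x = sqrt 2 C^(1/2) y + m, where
    C^(1/2) is the Cholesky factor. The density becomes pi^(-d/2) e^(-y.y) up
    to the Jacobian ([gauss_pdf_whiten]), and the affine forms become affine
    in y, so that the rest of the integrand is a polynomial of degree at most
    beta, on which Gauss-Hermite quadrature is exact. The only substitutions
    ever used are triangular with positive diagonal, and these follow by
    induction on the dimension from Tonelli's theorem and the one-dimensional
    case ([ge0_integral_col_triangular]). *)

(** * Triangular affine changes of variables *)

Lemma measurable_affine1 (R : realType) (a b : R) :
  measurable_fun [set: measurableTypeR R]
    (fun t : measurableTypeR R => (a * t + b) : measurableTypeR R).
Proof.
apply: (@measurable_funD _ _ R setT (fun t : R => a * t) (cst b)) => //.
exact: (@measurable_funM _ _ R setT (cst a) id).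
Qed.

(** Both sides are measures, so agreement on half-open intervals suffices. *)
Lemma lebesgue_measure_affine (R : realType) (a b : R) (A : set R) : 0 < a ->
  measurable A ->
  (@lebesgue_measure R A = a%:E *
    pushforward (@lebesgue_measure R) (fun t => (a * t + b)%R) A)%E.
Proof.
move=> a0 mA.
pose k : {nonneg R} := NngNum (ltW a0).
pose phi := (fun t => (a * t + b)) : measurableTypeR R -> measurableTypeR R.
have mphi : measurable_fun setT phi by exact: measurable_affine1.
rewrite (@lebesgue_measure_unique _
  (mscale k (pushforward (@lebesgue_measure R) phi)))// => _ [[u v] _ <-].
rewrite /= /mscale/= /pushforward /=.
have -> : phi @^-1` `]u, v] = `]((u - b) / a), ((v - b) / a)]%classic.
  apply/seteqP; split => t /=; rewrite !in_itv/= /phi => /andP[tu tv].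
    by rewrite ltr_pdivrMr// ler_pdivlMr// ltrBlDr lerBrDr mulrC tu.
  move: tu tv; rewrite ltr_pdivrMr// ler_pdivlMr// ltrBlDr lerBrDr mulrC.
  by move=> -> ->.
rewrite !lebesgue_measure_itv /= !lte_fin ltr_pM2r ?invr_gt0// ltrD2r.
case: ifPn => _; last by rewrite mule0.
rewrite -EFinD -EFinM; congr (_%:E); rewrite -mulrBl mulrCA mulfV ?gt_eqF//.
by rewrite opprB addrA subrK mulr1.
Qed.

Lemma ge0_integral_affine1 (R : realType) (a b : R) (f : R -> \bar R) : 0 < a ->
  measurable_fun [set: R] f -> (forall t, 0 <= f t)%E ->
  (\int[@lebesgue_measure R]_t f t =
   a%:E * \int[@lebesgue_measure R]_t f (a * t + b)%R)%E.
Proof.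
move=> a0 mf f0.
pose k : {nonneg R} := NngNum (ltW a0).
pose phi := (fun t => (a * t + b)) : measurableTypeR R -> measurableTypeR R.
have mphi : measurable_fun setT phi by exact: measurable_affine1.
pose nu : {measure set (measurableTypeR R) -> \bar R} :=
  mscale k (pushforward (@lebesgue_measure R) phi).
transitivity (\int[nu mphi]_t f t)%E.
  apply: eq_measure_integral => A mA _.
  exact: lebesgue_measure_affine.
rewrite ge0_integral_mscale//; congr (_ * _)%E.
by rewrite (@ge0_integral_pushforward _ _ _ _ _ phi mphi).
Qed.

Lemma measurable_mulmxD (R : realType) n p (A : 'M[R]_(p, n)) (b : 'cV[R]_p) :
  measurable_fun [set: 'cV[R]_n] (fun x : 'cV[R]_n => A *m x + b).
Proof.
apply/measurable_fun_colP => i.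
rewrite (_ : (fun _ => _) =
  (fun x : 'cV[R]_n => (\sum_k A i k * x k 0) + b i 0)); last first.
  by apply/funext => x; rewrite !mxE.
apply: measurable_funD; last exact: measurable_cst.
apply: measurable_sum => k; apply: measurable_funM; first exact: measurable_cst.
exact: measurable_coord.
Qed.

Lemma ge0_integral_col_recl (R : realType) n (f : 'cV[R]_n.+1 -> \bar R) :
  measurable_fun [set: 'cV[R]_n.+1] f -> (forall x, 0 <= f x)%E ->
  (\int[lebesgue_col n.+1]_x f x =
   \int[@lebesgue_measure R]_t \int[lebesgue_col n]_x f (ccons (t, x)))%E.
Proof.
move=> mf f0; rewrite /= /lebesgue_step.
rewrite (ge0_integral_pushforward (@measurable_ccons R n))// preimage_setT.
rewrite (@fubini_tonelli1 _ _ _ _ _ _ _ (f \o @ccons R n))//.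
  by apply: measurableT_comp => //; exact: measurable_ccons.
by move=> x /=.
Qed.

(** Lower triangularity makes the first output coordinate depend on the first
    input only. Once that input t is fixed, the other outputs form a
    triangular affine map in the other inputs, in which t merely shifts the
    translation vector, so the induction must allow an arbitrary b. *)
Lemma ge0_integral_col_triangular (R : realType) n (A : 'M[R]_n) (b : 'cV[R]_n)
    (f : 'cV[R]_n -> \bar R) :
  is_trig_mx A -> (forall i, 0 < A i i) ->
  measurable_fun [set: 'cV[R]_n] f -> (forall x, 0 <= f x)%E ->
  (\int[lebesgue_col n]_x f x =
   (\det A)%:E * \int[lebesgue_col n]_x f (A *m x + b)%R)%E.
Proof.
move=> trigA A0; rewrite det_trig//.
elim: n A b f trigA A0 => [|n IHn] A b f /is_trig_mxP trigA A0 mf f0.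
  rewrite big_ord0 mul1e; apply: eq_integral => x _; congr f.
  exact/matrixP/(fun i => False_ind _ (notF (ltn_ord i))).
pose A' : 'M[R]_n := \matrix_(i, j) A (lift ord0 i) (lift ord0 j).
pose c : 'cV[R]_n := \col_i A (lift ord0 i) ord0.
pose b' : 'cV[R]_n := \col_i b (lift ord0 i) 0.
(* Split off the first row and column of A; the input t contributes t *: c. *)
have affE t x : A *m ccons (t, x) + b =
    ccons (A ord0 ord0 * t + b ord0 0, A' *m x + (t *: c + b')).
  apply/colP => i; rewrite mxE [X in X + _]mxE big_ord_recl ccons0.
  under eq_bigr do rewrite cconsS /=.
  have [k ->|->] := fintype.unliftP ord0 i.
    rewrite cconsS !mxE [X in X + _]addrC -addrA mulrC; congr (_ + (_ + _)).
    by apply: eq_bigr => l _; rewrite mxE.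
  by rewrite ccons0 big1 ?addr0// => l _; rewrite trigA ?mul0r.
have mccons t : measurable_fun [set: 'cV[R]_n] (fun x => ccons (t, x)).
  apply: (measurableT_comp (@measurable_ccons R n)).
  exact: measurable_pair1.
pose g t := (\int[lebesgue_col n]_x f (ccons (t, x)))%E.
have mg : measurable_fun [set: measurableTypeR R] g.
  apply: (@measurable_fun_fubini_tonelli_F _ _ _ _ _ _ (f \o @ccons R n)) =>
    [|p]; last exact: f0.
  by apply: measurableT_comp => //; exact: measurable_ccons.
have g0 t : (0 <= g t)%E by exact: integral_ge0.
rewrite ge0_integral_col_recl//.
rewrite (ge0_integral_affine1 (b ord0 0) (A0 ord0) mg g0).
rewrite big_ord_recl EFinM -muleA; congr (_ * _)%E.
have trigA' : is_trig_mx A' by apply/is_trig_mxP => i j ij; rewrite mxE trigA.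
have A'0 i : 0 < A' i i by rewrite mxE.
rewrite (ge0_integral_col_recl (f := fun x => f (A *m x + b)))//; last first.
  by apply: measurableT_comp => //; exact: measurable_mulmxD.
transitivity (\int[@lebesgue_measure R]_t
   ((\prod_(i < n) A (lift ord0 i) (lift ord0 i))%:E *
   \int[lebesgue_col n]_x f (A *m ccons (t, x) + b)%R))%E.
  apply: eq_integral => t _; rewrite /g.
  rewrite (IHn A' (t *: c + b'))//; last exact: measurableT_comp.
  congr (_%:E * _)%E; first by apply: eq_bigr => i _; rewrite mxE.
  by apply: eq_integral => x _; rewrite affE.
rewrite ge0_integralZl//.
- apply: (@measurable_fun_fubini_tonelli_F _ _ _ _ _ _
    (fun p => f (A *m ccons p + b))) => [|p]; last exact: f0.
  apply: (measurableT_comp mf).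
  apply: (measurableT_comp (measurable_mulmxD A b)).
  exact: measurable_ccons.
- by move=> t _; exact: integral_ge0.
- by rewrite lee_fin prodr_ge0// => i _; exact: ltW.
Qed.

Lemma det_trig_gt0 (R : realType) n (A : 'M[R]_n) :
  is_trig_mx A -> (forall i, 0 < A i i) -> 0 < \det A.
Proof. by move=> trigA A0; rewrite det_trig// prodr_gt0. Qed.

(** Keeping the determinant inside the integral makes the identity hold for
    every measurable f: it acts on the positive and the negative part
    separately, with no cancellation of infinities to exclude. *)
Lemma integral_col_triangular (R : realType) n (A : 'M[R]_n) (b : 'cV[R]_n)
    (f : 'cV[R]_n -> R) :
  is_trig_mx A -> (forall i, 0 < A i i) ->
  measurable_fun [set: 'cV[R]_n] f ->
  (\int[lebesgue_col n]_x (f x)%:E =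
   \int[lebesgue_col n]_x (\det A * f (A *m x + b))%:E)%E.
Proof.
move=> trigA A0 mf.
have mfE : measurable_fun setT (EFin \o f) by exact/measurable_EFinP.
have mAb := measurable_mulmxD A b.
have detA0 := ltW (det_trig_gt0 trigA A0).
pose fAb x := (f (A *m x + b))%:E.
have mfAb : measurable_fun setT fAb by exact: (measurableT_comp mfE mAb).
rewrite [LHS]integralE [RHS]integralE.
congr (_ - _)%E; rewrite (ge0_integral_col_triangular b trigA A0)//.
- rewrite (ge0_funeposM fAb detA0) ge0_integralZl//.
  + by congr (_ * _)%E; apply: eq_integral => x _; rewrite !funeposE.
  + exact: measurable_funepos.
- exact: measurable_funepos.
- rewrite (ge0_funenegM fAb detA0) ge0_integralZl//.
  + by congr (_ * _)%E; apply: eq_integral => x _; rewrite !funenegE.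
  + exact: measurable_funeneg.
- exact: measurable_funeneg.
Qed.

Lemma ge0_integral_col_translate (R : realType) n (b : 'cV[R]_n)
    (f : 'cV[R]_n -> \bar R) :
  measurable_fun [set: 'cV[R]_n] f -> (forall x, 0 <= f x)%E ->
  (\int[lebesgue_col n]_x f (x + b)%R = \int[lebesgue_col n]_x f x)%E.
Proof.
move=> mf f0.
rewrite [RHS](ge0_integral_col_triangular (A := 1%:M) b)//.
  by rewrite det1 mul1e; apply: eq_integral => x _; rewrite mul1mx.
by move=> i; rewrite mxE eqxx.
Qed.

(** * Integration against a density *)

(** By uniqueness of Radon-Nikodym derivatives, p is almost everywhere the
    derivative of nu with respect to mu. *)
Lemma ge0_integral_density d (T : measurableType d) (R : realType)
    (nu : probability T R) (mu : {sigma_finite_measure set T -> \bar R})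
    (p f : T -> \bar R) :
  measurable_fun [set: T] p -> (forall x, 0 <= p x)%E ->
  (forall A, measurable A -> nu A = \int[mu]_(x in A) p x)%E ->
  measurable_fun [set: T] f -> (forall x, 0 <= f x)%E ->
  (\int[nu]_x f x = \int[mu]_x (f x * p x))%E.
Proof.
move=> mp p0 nuE mf f0.
have numu : nu `<< mu.
  apply/null_content_dominatesP => A mA muA0; rewrite nuE//.
  by apply: null_set_integral => //; exact: measurable_funTS.
rewrite -(Radon_Nikodym_SigmaFinite.change_of_variables numu)//.
have mRN := measurable_int _ (Radon_Nikodym_SigmaFinite.f_integrable numu).
apply: ae_eq_integral => //; [exact: emeasurable_funM..|].
apply: ae_eqe_mul2l; apply: integral_ae_eq => //.
- exact: Radon_Nikodym_SigmaFinite.f_integrable.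
- by move=> A _ mA; rewrite -nuE// -Radon_Nikodym_SigmaFinite.f_integral.
Qed.

Lemma integral_density d (T : measurableType d) (R : realType)
    (nu : probability T R) (mu : {sigma_finite_measure set T -> \bar R})
    (p f : T -> R) :
  measurable_fun [set: T] p -> (forall x, 0 <= p x) ->
  (forall A, measurable A -> nu A = \int[mu]_(x in A) (p x)%:E)%E ->
  measurable_fun [set: T] f ->
  (\int[nu]_x (f x)%:E = \int[mu]_x (p x * f x)%:E)%E.
Proof.
move=> mp p0 nuE mf.
have mpE : measurable_fun setT (EFin \o p) by exact/measurable_EFinP.
have mfE : measurable_fun setT (EFin \o f) by exact/measurable_EFinP.
have pE0 x : (0 <= (EFin \o p) x)%E by rewrite lee_fin.
rewrite integralE [RHS]integralE.
rewrite (ge0_integral_density mpE pE0 nuE)//; last exact: measurable_funepos.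
rewrite (ge0_integral_density mpE pE0 nuE)//; last exact: measurable_funeneg.
congr (_ - _)%E; apply: eq_integral => x _; rewrite muleC.
- have /(congr1 (fun g => g x))/esym := ge0_funeposM (EFin \o f) (p0 x).
  by rewrite /= => ->; rewrite !funeposE.
- have /(congr1 (fun g => g x))/esym := ge0_funenegM (EFin \o f) (p0 x).
  by rewrite /= => ->; rewrite !funenegE.
Qed.

Lemma Rintegral_sum d (T : measurableType d) (R : realType)
    (mu : {measure set T -> \bar R}) (I : Type) (s : seq I) (f : I -> T -> R) :
  (forall i, mu.-integrable setT (EFin \o f i)) ->
  \int[mu]_x (\sum_(i <- s) f i x) = \sum_(i <- s) \int[mu]_x f i x.
Proof.
move=> intf; rewrite /Rintegral.
under eq_integral do rewrite -sumEFin.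
rewrite (integral_sum measurableT intf) sum_fine//= => i _.
exact: (integrable_fin_num measurableT (intf i)).
Qed.

(** * Gaussian densities *)

Lemma spd_unitmx (R : realType) d (C : 'M[R]_d) : spd C -> C \in unitmx.
Proof.
move=> [_ posC]; rewrite unitmxE unitfE; apply/negP => /det0P[v v0 vC].
have := posC v^T; rewrite trmxK vC mul0mx mxE ltxx trmx_eq0 => /(_ v0).
by [].
Qed.

Lemma spd_invmx_sym (R : realType) d (C : 'M[R]_d) :
  spd C -> (invmx C)^T = invmx C.
Proof. by move=> [symC _]; rewrite trmx_inv symC. Qed.

Lemma quad_formD (R : realType) d (Q : 'M[R]_d) (u v : 'cV[R]_d) : Q^T = Q ->
  ((u + v)^T *m Q *m (u + v)) 0 0 =
  (u^T *m Q *m u) 0 0 + 2 * (v^T *m Q *m u) 0 0 + (v^T *m Q *m v) 0 0.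
Proof.
move=> symQ.
have uv : (u^T *m Q *m v) 0 0 = (v^T *m Q *m u) 0 0.
  rewrite -[u^T *m Q *m v]trmxK [LHS]mxE.
  by rewrite trmx_mul trmx_mul trmxK symQ mulmxA.
have addE (M N : 'M[R]_1) : (M + N) 0 0 = M 0 0 + N 0 0 by rewrite mxE.
rewrite [(u + v)^T]linearD /= !mulmxDl !mulmxDr !addE uv.
ring.
Qed.

(** Reduces directional derivatives in R^d to calculus in one variable. *)
Lemma derive_along_line (R : realType) d (f : 'cV[R]_d -> R)
    (x v : 'cV[R]_d) :
  'D_v f x = 'D_1 (fun h : R => f (h *: v + x)) 0.
Proof.
rewrite /derive; set g := (fun h : R => f (h *: v + x)).
set F := (fun _ : R => _); set G := (fun _ : R => _).
suff -> : F = G by []; apply/funext => h; rewrite /F /G /g /=.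
by rewrite addr0 scale0r add0r [h *: 1]mulr1.
Qed.

Lemma grad_gauss_pdf (R : realType) d (m : 'cV[R]_d) (C : 'M[R]_d)
    (x : 'cV[R]_d) : C^T = C ->
  grad (gauss_pdf m C) x = gauss_pdf m C x *: (invmx C *m (m - x)).
Proof.
move=> symC; apply/colP => a; rewrite mxE derive_along_line.
have symQ : (invmx C)^T = invmx C by rewrite trmx_inv symC.
set v : 'cV[R]_d := delta_mx a 0.
pose K : R := (2 * pi) `^ (- (d%:R / 2)) * (\det C) `^ (- 2^-1).
pose c0 : R := ((x - m)^T *m invmx C *m (x - m)) 0 0.
pose c1 : R := (v^T *m invmx C *m (x - m)) 0 0.
pose c2 : R := (v^T *m invmx C *m v) 0 0.
(* Along the line, the exponent is quadratic in h, with derivative - c1 at 0. *)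
rewrite (_ : (fun _ => _) = (fun h : R =>
    K * expR (- 2^-1 * (c0 + 2 * (h * c1) + h * (h * c2))))); last first.
  apply/funext => h; rewrite /gauss_pdf; congr (_ * expR (_ * _)).
  have scaleE t (M : 'M[R]_1) : (t *: M) 0 0 = t * M 0 0 by rewrite mxE.
  rewrite -addrA addrC quad_formD// [(h *: v)^T]linearZ /=.
  by rewrite -!scalemxAl -!scalemxAr !scaleE.
have -> : (gauss_pdf m C x *: (invmx C *m (m - x))) a 0 =
    K * expR (- 2^-1 * c0) * - c1.
  rewrite [LHS]mxE; congr (_ * _).
  by rewrite -opprB mulmxN mxE /c1 trmx_delta -mulmxA -rowE [in RHS]mxE.
pose p : {poly R} := (- 2^-1) *: (c0%:P + (2 * c1) *: 'X + c2 *: 'X^2).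
rewrite (_ : (fun _ => _) = K \*: (expR \o horner p)); last first.
  apply/funext => h /=; congr (_ * expR _).
  by rewrite !hornerE /=; ring.
rewrite (derive_val (is_derive := is_deriveZ K (is_derive1_comp
  (is_derive_expR (p.[0])) (is_derive_poly p 0)))).
rewrite /p !poly.derivE !hornerE /=.
rewrite !(mulr0, mul0r, addr0) -mulrA [LHS]mulrA; congr (_ * _).
by rewrite mulNr mulrA mulVf ?mul1r ?pnatr_eq0.
Qed.

Lemma gauss_pdf_ge0 (R : realType) d (m : 'cV[R]_d) (C : 'M[R]_d) x :
  0 <= gauss_pdf m C x.
Proof. by rewrite !mulr_ge0 ?powR_ge0 ?expR_ge0. Qed.

Lemma measurable_quad_form (R : realType) d (Q : 'M[R]_d) :
  measurable_fun [set: 'cV[R]_d] (fun x : 'cV[R]_d => (x^T *m Q *m x) 0 0).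
Proof.
rewrite (_ : (fun _ => _) =
  (fun x : 'cV[R]_d => \sum_j (\sum_k x k 0 * Q k j) * x j 0)); last first.
  apply/funext => x; rewrite mxE; apply: eq_bigr => j _; rewrite mxE.
  by congr (_ * _); apply: eq_bigr => k _; rewrite mxE.
apply: measurable_sum => j; apply: measurable_funM; last first.
  exact: measurable_coord.
apply: measurable_sum => k; apply: measurable_funM; last exact: measurable_cst.
exact: measurable_coord.
Qed.

Lemma measurable_gauss_pdf (R : realType) d (m : 'cV[R]_d) (C : 'M[R]_d) :
  measurable_fun [set: 'cV[R]_d] (gauss_pdf m C).
Proof.
rewrite /gauss_pdf; apply: measurable_funM; first exact: measurable_cst.
apply: (measurableT_comp (@measurable_expR R)).
apply: measurable_funM; first exact: measurable_cst.
rewrite (_ : (fun _ => _) = (fun x => (x^T *m invmx C *m x) 0 0) \o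
    (fun x : 'cV[R]_d => 1%:M *m x + - m)); last first.
  by apply/funext => x /=; rewrite mul1mx.
apply: measurableT_comp; first exact: measurable_quad_form.
exact: measurable_mulmxD.
Qed.

(** Completing the square: the linear term v.x is absorbed by moving the
    centre of the Gaussian from m to m + C v. *)
Lemma gauss_pdf_tilt (R : realType) d (m v x : 'cV[R]_d) (C : 'M[R]_d) :
  spd C ->
  expR ((v^T *m x) 0 0) * gauss_pdf m C x =
  expR ((v^T *m m) 0 0 + 2^-1 * (v^T *m C *m v) 0 0) *
    gauss_pdf m C (x - C *m v).
Proof.
move=> spdC; have unitC := spd_unitmx spdC; have [symC _] := spdC.
have symQ := spd_invmx_sym spdC.
rewrite /gauss_pdf [LHS]mulrCA [RHS]mulrCA; congr (_ * _).
rewrite -!expRD; congr expR.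
have -> : x - C *m v - m = (x - m) + - (C *m v) by rewrite addrAC.
have vQ : (- (C *m v))^T *m invmx C = - v^T.
  by rewrite linearN /= trmx_mul symC mulNmx -mulmxA mulmxV// mulmx1.
rewrite (quad_formD (x - m) _ symQ) vQ !mulNmx !mulmxN opprK.
set q := _ *m invmx C *m (x - m); rewrite mulmxBr mulmxA.
have oppE (M : 'M[R]_1) : (- M) 0 0 = - M 0 0 by rewrite mxE.
have addE (M N : 'M[R]_1) : (M + N) 0 0 = M 0 0 + N 0 0 by rewrite mxE.
rewrite !(oppE, addE).
lra.
Qed.

(** The powers of 2 cancel: det (sqrt 2 A) contributes 2^(d/2), which turns
    (2 pi)^(-d/2) into pi^(-d/2), while det A cancels (det C)^(-1/2). *)
Lemma gauss_pdf_whiten (R : realType) d (m : 'cV[R]_d) (C A : 'M[R]_d)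
    (y : 'cV[R]_d) : cholesky_factor A C ->
  \det (Num.sqrt 2 *: A) * gauss_pdf m C (Num.sqrt 2 *: A *m y + m) =
  pi `^ (- (d%:R / 2)) * expR (- (y^T *m y) 0 0).
Proof.
move=> [trigA A0 CE]; have detA0 := det_trig_gt0 trigA A0.
have unitA : A \in unitmx by rewrite unitmxE unitfE gt_eqF.
have unitC : C \in unitmx by rewrite -CE unitmx_mul unitmx_tr unitA.
have CiE : A^T *m invmx C *m A = 1%:M.
  by apply: mulmx1C; rewrite mulmxA CE mulmxV.
rewrite /gauss_pdf addrK [RHS]mulrC.
have -> : ((Num.sqrt 2 *: A *m y)^T *m invmx C *m (Num.sqrt 2 *: A *m y)) =
    2 *: (y^T *m y).
  rewrite -!scalemxAl [(_ *: _)^T]linearZ /= -!scalemxAl -scalemxAr.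
  rewrite scalerA -expr2.
  have -> : (A *m y)^T *m invmx C *m (A *m y) =
      y^T *m (A^T *m invmx C *m A) *m y by rewrite trmx_mul !mulmxA.
  by rewrite CiE mulmx1 sqr_sqrtr ?ler0n.
rewrite [X in expR (_ * X)]mxE mulNr mulKf ?pnatr_eq0// mulrA mulrC.
congr (_ * _).
have -> : \det C `^ (- 2^-1) = (\det A)^-1.
  rewrite powRN powR12_sqrt; last first.
    by rewrite -CE det_mulmx det_tr -expr2 sqr_ge0.
  by rewrite -CE det_mulmx det_tr -expr2 sqrtr_sqr gtr0_norm.
rewrite detZ [X in _ * X]mulrC mulrA mulfK ?gt_eqF//.
have -> : Num.sqrt 2 = 2 `^ 2^-1 :> R by rewrite powR12_sqrt.
rewrite powRM ?pi_ge0// mulrA -powR_mulrn ?powR_ge0// -powRrM -powRD.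
  by rewrite [2^-1 * _]mulrC subrr powRr0 mul1r.
by rewrite pnatr_eq0 implybT.
Qed.

(** * Products of affine forms under a Gaussian *)

(** An equality of functions rather than a pointwise one, so that witnesses
    for a whole family can be chosen and rewritten with. *)
Definition affine_form (R : realType) d (f : 'cV[R]_d -> R) : Prop :=
  exists (c : R) (u : 'cV[R]_d), f = (fun x => c + (u^T *m x) 0 0).

Lemma affine_form_cst (R : realType) d (c : R) :
  affine_form (fun _ : 'cV[R]_d => c).
Proof.
by exists c, 0; apply/funext => x; rewrite trmx0 mul0mx mxE addr0.
Qed.

Lemma affine_form_mulmxD (R : realType) d n (B : 'M[R]_(n, d)) (b : 'cV[R]_n)
    (f : 'cV[R]_n -> R) :
  affine_form f -> affine_form (fun x => f (B *m x + b)).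
Proof.
move=> [c [u ->]]; exists (c + (u^T *m b) 0 0), (B^T *m u).
apply/funext => x; rewrite trmx_mul trmxK mulmxDr mulmxA [X in c + X]mxE.
by rewrite addrA addrAC.
Qed.

Lemma affine_form_coord (R : realType) d (a : 'I_d) :
  affine_form (fun x : 'cV[R]_d => x a 0).
Proof.
exists 0, (delta_mx a 0); apply/funext => x.
by rewrite trmx_delta -rowE mxE add0r.
Qed.

Lemma measurable_affine_form (R : realType) d (f : 'cV[R]_d -> R) :
  affine_form f -> measurable_fun [set: 'cV[R]_d] f.
Proof.
move=> [c [u ->]].
rewrite (_ : (fun _ => _) = (fun y : 'cV[R]_1 => y 0 0) \o
    (fun x : 'cV[R]_d => u^T *m x + c%:M)); last first.
  have cE : (c%:M : 'M[R]_1) 0 0 = c by rewrite mxE eqxx mulr1n.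
  by apply/funext => x /=; rewrite addrC [RHS]mxE cE.
exact: (measurableT_comp (measurable_coord 0) (measurable_mulmxD _ _)).
Qed.

Lemma measurable_prod_affine (R : realType) d (I : finType)
    (f : I -> 'cV[R]_d -> R) :
  (forall i, affine_form (f i)) ->
  measurable_fun [set: 'cV[R]_d] (fun x => \prod_i f i x).
Proof.
by move=> aff; apply: measurable_prod => i _; exact: measurable_affine_form.
Qed.

Lemma normr_le_expRD (R : realType) (t : R) : `|t| <= expR t + expR (- t).
Proof.
have := expR_ge1Dx t; have := expR_ge1Dx (- t).
have := expR_gt0 t; have := expR_gt0 (- t).
rewrite ler_norml; lra.
Qed.

(** The moment generating function of a Gaussian is finite: up to a constant,
    the integrand is a translate of the density. *)
Lemma integrable_gauss_expR (R : realType) d (m v : 'cV[R]_d) (C : 'M[R]_d) :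
  spd C -> (lebesgue_col d).-integrable setT (EFin \o gauss_pdf m C) ->
  (lebesgue_col d).-integrable setT
    (fun x => (gauss_pdf m C x * expR ((v^T *m x) 0 0))%:E).
Proof.
move=> spdC /integrableP[mg goo].
have mgT : measurable_fun [set: 'cV[R]_d]
    (fun x : 'cV[R]_d => gauss_pdf m C (x - C *m v)).
  rewrite (_ : (fun _ => _) = gauss_pdf m C \o
      (fun x : 'cV[R]_d => 1%:M *m x + - (C *m v))); last first.
    by apply/funext => x /=; rewrite mul1mx.
  apply: measurableT_comp; first exact: measurable_gauss_pdf.
  exact: measurable_mulmxD.
rewrite (_ : (fun _ => _) =
  (fun x : 'cV[R]_d => (expR ((v^T *m m) 0 0 + 2^-1 * (v^T *m C *m v) 0 0))%:E *
    (gauss_pdf m C (x - C *m v))%:E)%E); last first.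
  by apply/funext => x; rewrite -EFinM mulrC gauss_pdf_tilt.
apply: integrableZl => //; apply/integrableP; split.
  exact/measurable_EFinP.
rewrite (ge0_integral_col_translate (- (C *m v))
  (f := fun x => `|(gauss_pdf m C x)%:E|%E))//.
exact: measurableT_comp.
Qed.

(** Distributing the product of the bounds |f i| <= e^(f i) + e^(- f i)
    yields one exponential of an affine form for each choice of signs. *)
Lemma integrable_gauss_prod_affine (R : realType) d (m : 'cV[R]_d)
    (C : 'M[R]_d) (I : finType) (f : I -> 'cV[R]_d -> R) :
  spd C -> (lebesgue_col d).-integrable setT (EFin \o gauss_pdf m C) ->
  (forall i, affine_form (f i)) ->
  (lebesgue_col d).-integrable setT
    (fun x => (gauss_pdf m C x * \prod_i f i x)%:E).
Proof.
move=> spdC intC aff.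
have [c fE] := choice aff; have {fE}[u fE] := choice fE.
(* J is the set of the factors from which e^(f i), not e^(- f i), is taken. *)
pose sgn (J : {set I}) i : R := if i \in J then 1 else -1.
pose k J := \sum_i sgn J i * c i.
pose v J := \sum_i sgn J i *: u i.
have bound x : `|\prod_i f i x| <=
    \sum_(J : {set I}) expR (k J) * expR (((v J)^T *m x) 0 0).
  rewrite normr_prod.
  apply: (@le_trans _ _ (\prod_i (expR (f i x) + expR (- f i x)))).
    by apply: ler_prod => i _; rewrite normr_ge0 normr_le_expRD.
  rewrite bigA_distr; apply: ler_sum => J _.
  rewrite -expRD /k /v linear_sum /= mulmx_suml summxE -big_split /= expR_sum.
  apply: ler_prod => i _; rewrite fun_if !expR_ge0 if_same /=.
  have scaleE t (M : 'M[R]_1) : (t *: M) 0 0 = t * M 0 0 by rewrite mxE.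
  rewrite fE linearZ /= -scalemxAl scaleE -mulrDr /sgn.
  by case: ifP => _; rewrite ?mul1r ?mulN1r.
apply: (le_integrable measurableT (g := fun x => \sum_(J : {set I})
    ((expR (k J))%:E * (gauss_pdf m C x * expR (((v J)^T *m x) 0 0))%:E)%E)).
- apply/measurable_EFinP; apply: measurable_funM.
    exact: measurable_gauss_pdf.
  exact: measurable_prod_affine.
- move=> x _ /=.
  under [X in (_ <= `|X|)%E]eq_bigr do rewrite -EFinM mulrCA.
  rewrite sumEFin /= lee_fin -mulr_sumr !normrM ler_pM//.
  by rewrite (le_trans (bound x))// ler_norm.
- apply: integrable_sum => // J _; apply: integrableZl => //.
  exact: integrable_gauss_expR.
Qed.

Lemma gaussian_rv_integrable (R : realType) d (disp : measure_display)
    (Omega : measurableType disp) (P : probability Omega R)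
    (X : {RV P >-> 'cV[R]_d}) (m : 'cV[R]_d) (C : 'M[R]_d) :
  gaussian_rv X m C ->
  (lebesgue_col d).-integrable setT (EFin \o gauss_pdf m C).
Proof.
move=> gaussX; apply/integrableP; split.
  apply/measurable_EFinP; exact: measurable_gauss_pdf.
under eq_integral do rewrite gee0_abs ?lee_fin ?gauss_pdf_ge0//.
by rewrite -gaussX// probability_setT ltry.
Qed.

(** Transporting to the law of X, and from there to its density, acts on the
    positive and negative parts of f separately. *)
Lemma expectation_gaussian_rv (R : realType) d (disp : measure_display)
    (Omega : measurableType disp) (P : probability Omega R)
    (X : {RV P >-> 'cV[R]_d}) (m : 'cV[R]_d) (C : 'M[R]_d)
    (f : 'cV[R]_d -> R) :
  gaussian_rv X m C -> measurable_fun [set: 'cV[R]_d] f ->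
  ('E_P[fun w => f (X w)] =
   \int[lebesgue_col d]_x (gauss_pdf m C x * f x)%:E)%E.
Proof.
move=> gaussX mf; have mg := measurable_gauss_pdf m C.
have mfE : measurable_fun setT (EFin \o f) by exact/measurable_EFinP.
rewrite -(integral_density mg (gauss_pdf_ge0 m C) gaussX mf).
rewrite expectation.unlock integralE [RHS]integralE.
rewrite !ge0_integral_distribution//.
- by congr (_ - _)%E; apply: eq_integral => w _ /=; rewrite ?funeposE ?funenegE.
- exact: measurable_funeneg.
- exact: measurable_funepos.
Qed.

(** * Gauss-Hermite quadrature of products of affine forms *)

Lemma affine_form_mpoly (R : realType) d (f : 'cV[R]_d -> R) : affine_form f ->
  exists p : mpoly.mpoly d R, (mpoly.msize p <= 2)%N /\
    forall x : 'cV[R]_d, mpoly.meval (fun a => x a 0) p = f x.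
Proof.
move=> [c [u ->]].
exists (mpoly.mpolyC d c +
  \sum_(a < d) u a 0 *: mpoly.mpolyX R (mpoly.mnm1 a)); split.
- apply: (leq_trans (mpoly.msizeD_le _ _)); rewrite geq_max mpoly.msizeC.
  apply/andP; split; first by case: (_ != 0).
  apply: (leq_trans (mpoly.msize_sum _ _ _)); apply/bigmax_leqP => a _.
  by apply: (leq_trans (mpoly.msizeZ_le _ _)); rewrite mpoly.msizeX mpoly.mdeg1.
- move=> x; rewrite mpoly.mevalD mpoly.mevalC raddf_sum /= mxE.
  congr (_ + _); apply: eq_bigr => a _.
  by rewrite mpoly.mevalZ mpoly.mevalXU mxE.
Qed.

(** [mpoly.msize] is one more than the degree, hence the shifts by one: the
    degrees bounded by k add up. *)
Lemma msize_prod_le (R : idomainType) n (I : Type) (s : seq I) k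
    (p : I -> mpoly.mpoly n R) :
  (forall i, mpoly.msize (p i) <= k.+1)%N ->
  (mpoly.msize (\prod_(i <- s) p i) <= (size s * k).+1)%N.
Proof.
move=> pk; elim: s => [|i s IHs]; first by rewrite big_nil mpoly.msize1.
rewrite big_cons; have [->|p0] := eqVneq (p i) 0.
  by rewrite mul0r mpoly.msize0.
have [->|q0] := eqVneq (\prod_(i <- s) p i) 0.
  by rewrite mulr0 mpoly.msize0.
rewrite mpoly.msizeM//= mulSn -addnS.
by rewrite -subn1 leq_subLR add1n -addSn leq_add.
Qed.

(** The constant Z pi^(-d/2) is made part of the polynomial, so that the
    quadrature rule applies to the whole integrand and no constant has to be
    moved out of an integral. *)
Lemma gauss_hermite_prod_affine (R : realType) d (m : 'cV[R]_d)
    (C A : 'M[R]_d) k (f : 'I_k -> 'cV[R]_d -> R) (Z : R)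
    N (y : 'I_N -> 'cV[R]_d) (w : 'I_N -> R) :
  cholesky_factor A C -> gauss_hermite k y w ->
  (forall b, affine_form (f b)) ->
  \int[lebesgue_col d]_x (Z * (gauss_pdf m C x * \prod_b f b x)) =
  Z * pi `^ (- (d%:R / 2)) *
    \sum_(n < N) w n * \prod_b f b (Num.sqrt 2 *: (A *m y n) + m).
Proof.
move=> cholA ghw aff; have [trigA A0 _] := cholA.
have s20 : 0 < Num.sqrt (2 : R) by rewrite sqrtr_gt0.
have trigB : is_trig_mx (Num.sqrt 2 *: A).
  by apply/is_trig_mxP => a b ab; rewrite mxE (is_trig_mxP trigA)// mulr0.
have B0 a : 0 < (Num.sqrt 2 *: A) a a by rewrite mxE mulr_gt0.
have affB b : affine_form (fun x : 'cV[R]_d => f b (Num.sqrt 2 *: A *m x + m)).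
  exact: affine_form_mulmxD.
have [p pP] := choice (fun b => affine_form_mpoly (affB b)).
set c := Z * _.
pose q := c *: \prod_b p b.
have qE (x : 'cV[R]_d) : mpoly.meval (fun a => x a 0) q =
    c * \prod_b f b (Num.sqrt 2 *: A *m x + m).
  rewrite /q mpoly.mevalZ rmorph_prod /=; congr (_ * _).
  by apply: eq_bigr => b _; have [_ ->] := pP b.
have sq : (mpoly.msize q <= k.+1)%N.
  apply: (leq_trans (mpoly.msizeZ_le _ _)).
  have p2 b : (mpoly.msize (p b) <= 2)%N by case: (pP b).
  have := msize_prod_le (index_enum 'I_k) p2.
  by rewrite muln1 -[index_enum _]enumT size_enum_ord.
have := ghw q sq; rewrite /Rintegral => ghq.
rewrite (integral_col_triangular m trigB B0); last first.
  apply: measurable_funM; first exact: measurable_cst.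
  apply: measurable_funM; first exact: measurable_gauss_pdf.
  exact: measurable_prod_affine.
rewrite mulr_sumr.
transitivity (\sum_(n < N) w n * mpoly.meval (fun a => y n a 0) q).
  rewrite -ghq; congr fine; apply: eq_integral => x _; congr (_%:E).
  have wx := gauss_pdf_whiten m x cholA.
  rewrite qE; set F := \prod_b _; set D := \det _; set G := gauss_pdf _ _ _.
  have -> : D * (Z * (G * F)) = Z * (D * G) * F by ring.
  by rewrite /D /G wx /c; ring.
by apply: eq_bigr => n _; rewrite qE scalemxAl mulrCA.
Qed.

(** * Permuted tensor modes *)

Lemma sigma_modes_lshift k (J : {set 'I_k}) (a : 'I_#|J|) :
  sigma_modes J (cast_ord (card_modes J) (lshift (k - #|J|) a)) = enum_val a.
Proof.
rewrite permE (tnth_nth (enum_val a)) /= nth_cat -cardE ltn_ord.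
by rewrite -enum_val_nth.
Qed.

(** As a product over all the remaining modes ignores their order, the only
    fact needed about the last modes is that the permutation sends them onto
    the complement of J. *)
Lemma prod_sigma_modes_rshift (R : comPzRingType) k (J : {set 'I_k})
    (F : 'I_k -> R) :
  \prod_(c < k - #|J|)
    F (sigma_modes J (cast_ord (card_modes J) (rshift #|J| c))) =
  \prod_(b | b \notin J) F b.
Proof.
rewrite [RHS](reindex_inj (@perm_inj _ (sigma_modes J))) /=.
rewrite (reindex (cast_ord (card_modes J))) /=; last first.
  exact: onW_bij (Bijective (cast_ordK _) (cast_ordKV _)).
rewrite big_split_ord /= [X in X * _]big_pred0 ?mul1r => [|a]; last first.
  by rewrite sigma_modes_in /= ltn_ord.
by apply: eq_bigl => c; rewrite sigma_modes_in /= ltnNge leq_addr.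
Qed.

(** Unlike a power of a single vector, the factors v b differ from mode to
    mode, so here it matters that the first #|J| modes reach J in ascending
    order. *)
Lemma perm_sigma_modesE (R : realType) d k (J : {set 'I_k})
    (v : 'I_k -> 'cV[R]_d) (B : tensor R d (k - #|J|))
    (l : {ffun 'I_k -> 'I_d}) :
  perm_modes (sigma_modes J) (tensor_cast (card_modes J)
    (tensor_mul (tensor_vec (fun a : 'I_#|J| => v (enum_val a))) B)) l =
  \prod_(b in J) v b (l b) 0 *
  B [ffun c => l (sigma_modes J (cast_ord (card_modes J) (rshift #|J| c)))].
Proof.
rewrite !ffunE; congr (_ * _).
  rewrite [RHS]big_enum_val /=; apply: eq_bigr => a _.
  by rewrite !ffunE sigma_modes_lshift.
by congr (B _); apply/ffunP => c; rewrite !ffunE.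
Qed.

(** The multi-index l comes from expanding the matrix products, and J from
    expanding the products of differences. *)
Lemma prod_mulmx_subr (R : realType) d k (Q : 'I_k -> 'M[R]_d)
    (mu : 'I_k -> 'cV[R]_d) (x : 'cV[R]_d) (i : {ffun 'I_k -> 'I_d}) :
  \prod_b (Q b *m (mu b - x)) (i b) 0 =
  \sum_(J : {set 'I_k}) \sum_(l : {ffun 'I_k -> 'I_d})
    (-1) ^+ (k - #|J|) * (\prod_b Q b (i b) (l b)) *
    (\prod_(b in J) mu b (l b) 0) * \prod_(b | b \notin J) x (l b) 0.
Proof.
rewrite exchange_big /=.
under eq_bigr do rewrite mxE.
rewrite bigA_distr_bigA /=; apply: eq_bigr => l _.
rewrite big_split /=.
under [X in _ * X]eq_bigr do rewrite !mxE.
rewrite bigA_distr big_distrr /=; apply: eq_bigr => J _.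
rewrite -!mulrA [RHS]mulrCA; congr (_ * _); rewrite mulrCA.
rewrite (bigID (mem J)) /=; congr (_ * _).
  by apply: eq_bigr => b ->.
under eq_bigr => b /negbTE -> do rewrite -mulN1r.
rewrite big_split /= prodr_const; congr (_ ^+ _ * _).
rewrite -[X in (X - _)%N](card_ord k) -(cardsC J) addKn.
by apply: eq_card => b; rewrite inE.
Qed.

(** * The two evaluations of the integral *)

Section gauss_grad.
Context (R : realType) (d L alpha beta : nat).
Context (m_ : 'I_L -> 'cV[R]_d) (C_ : 'I_L -> 'M[R]_d).
Context (i : 'I_alpha -> 'I_L) (j : 'I_beta -> 'I_L).
Context (Z : R) (m : 'cV[R]_d) (C : 'M[R]_d).
Context (spdC_ : forall l, spd (C_ l)).
Context (productE : forall x : 'cV[R]_d,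
  (\prod_(a < alpha) gauss_pdf (m_ (i a)) (C_ (i a)) x) *
  (\prod_(b < beta) gauss_pdf (m_ (j b)) (C_ (j b)) x) = Z * gauss_pdf m C x).

Let Q b := invmx (C_ (j b)).
Let mu b := m_ (j b).

(** Each gradient returns its own density, so the densities recombine into
    the full product. *)
Lemma gauss_grad_integralE (k : {ffun 'I_beta -> 'I_d}) :
  gauss_grad_integral m_ C_ i j k = \int[lebesgue_col d]_x
    (Z * (gauss_pdf m C x * \prod_b (Q b *m (mu b - x)) (k b) 0)).
Proof.
rewrite ffunE; apply: eq_Rintegral => x _.
rewrite ffunE mulrA -productE -mulrA; congr (_ * _).
rewrite ffunE -big_split; apply: eq_bigr => b _ /=.
by rewrite grad_gauss_pdf ?mxE//; case: (spdC_ (j b)).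
Qed.

Lemma affine_form_grad_factor b a :
  affine_form (fun x => (Q b *m (mu b - x)) a 0).
Proof.
rewrite (_ : (fun _ => _) =
  (fun x : 'cV[R]_d => (- Q b *m x + Q b *m mu b) a 0)); last first.
  by apply/funext => x; rewrite mulmxBr mulNmx addrC.
exact: (affine_form_mulmxD _ _ (@affine_form_coord R d a)).
Qed.

Lemma gauss_grad_integral_moments (disp : measure_display)
    (Omega : measurableType disp) (P : probability Omega R)
    (X : {RV P >-> 'cV[R]_d}) : spd C -> gaussian_rv X m C ->
  gauss_grad_integral m_ C_ i j =
    Z *: \sum_(J : {set 'I_beta})
      (-1) ^+ (beta - #|J|) *:
      contract_even (tensor_mx (fun b => invmx (C_ (j b))))
        (perm_modes (sigma_modes J)
          (tensor_cast (card_modes J)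
            (tensor_mul (tensor_vec (fun a : 'I_#|J| => m_ (j (enum_val a))))
                  (tensor_moment X (beta - #|J|))))).
Proof.
move=> spdC gaussX; apply/ffunP => k; rewrite gauss_grad_integralE.
have intC := gaussian_rv_integrable gaussX.
(* Constant factors 1 on J turn a monomial into a product over all modes. *)
have aff_mono (J : {set 'I_beta}) (l : {ffun 'I_beta -> 'I_d}) b :
    affine_form (fun x : 'cV[R]_d => if b \notin J then x (l b) 0 else 1).
  by case: (b \notin J); [exact: affine_form_coord|exact: affine_form_cst].
have int_mono (J : {set 'I_beta}) (l : {ffun 'I_beta -> 'I_d}) :
    (lebesgue_col d).-integrable setT
      (EFin \o (fun x => gauss_pdf m C x * \prod_(b | b \notin J) x (l b) 0)).
  rewrite /comp; under eq_fun do rewrite big_mkcond.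
  by apply: integrable_gauss_prod_affine.
have momentE (J : {set 'I_beta}) (l : {ffun 'I_beta -> 'I_d}) :
    \int[lebesgue_col d]_x
      (gauss_pdf m C x * \prod_(b | b \notin J) x (l b) 0) =
    tensor_moment X (beta - #|J|)
      [ffun c => l (sigma_modes J (cast_ord (card_modes J) (rshift #|J| c)))].
  rewrite ffunE /Rintegral -(expectation_gaussian_rv gaussX).
    congr (fine ('E_P[_])); apply/funext => w; rewrite ffunE.
    rewrite -prod_sigma_modes_rshift; apply: eq_bigr => c _.
    by rewrite ffunE.
  under eq_fun do rewrite big_mkcond.
  exact: measurable_prod_affine.
pose coef (J : {set 'I_beta}) (l : {ffun 'I_beta -> 'I_d}) : R :=
  Z * ((-1) ^+ (beta - #|J|) * (\prod_b Q b (k b) (l b)) *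
    \prod_(b in J) mu b (l b) 0).
transitivity (\int[lebesgue_col d]_x \sum_(J : {set 'I_beta})
    \sum_(l : {ffun 'I_beta -> 'I_d}) (coef J l *
      (gauss_pdf m C x * \prod_(b | b \notin J) x (l b) 0))).
  apply: eq_Rintegral => x _; rewrite prod_mulmx_subr mulrA big_distrr /=.
  apply: eq_bigr => J _; rewrite big_distrr /=; apply: eq_bigr => l _.
  by rewrite /coef; ring.
have int_coef J l : (lebesgue_col d).-integrable setT (EFin \o (fun x =>
    coef J l * (gauss_pdf m C x * \prod_(b | b \notin J) x (l b) 0))).
  exact: (integrableZl measurableT (coef J l) (int_mono J l)).
rewrite Rintegral_sum => [|J]; last first.
  rewrite /comp; under eq_fun do rewrite -sumEFin.
  by apply: integrable_sum => // l _; exact: int_coef.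
rewrite ffunE sum_ffunE [RHS](big_distrr Z) /=; apply: eq_bigr => J _.
rewrite Rintegral_sum; last exact: int_coef.
rewrite [in RHS]ffunE [in RHS]ffunE [RHS]mulrA big_distrr /=.
apply: eq_bigr => l _; rewrite RintegralZl//.
rewrite (perm_sigma_modesE (fun b => m_ (j b))) momentE.
rewrite [X in _ = _ * (X * _)]ffunE.
rewrite /coef -!mulrA; congr (_ * (_ * (_ * _))).
by apply: eq_bigr => b _; rewrite interleave_odd interleave_even.
Qed.

End gauss_grad.

Theorem theorem5p3 (R : realType) (d L : nat)
    (m_ : 'I_L -> 'cV[R]_d) (C_ : 'I_L -> 'M[R]_d)
    (spdC_ : forall l, spd (C_ l))
    (alpha beta : nat) (i : 'I_alpha -> 'I_L) (j : 'I_beta -> 'I_L)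
    (Z : R) (m : 'cV[R]_d) (C : 'M[R]_d)
    (Z_gt0 : 0 < Z) (spdC : spd C)
    (productE : forall x : 'cV[R]_d,
      (\prod_(a < alpha) gauss_pdf (m_ (i a)) (C_ (i a)) x) *
      (\prod_(b < beta) gauss_pdf (m_ (j b)) (C_ (j b)) x) =
      Z * gauss_pdf m C x)
    (disp : measure_display) (Omega : measurableType disp)
    (P : probability Omega R) (X : {RV P >-> 'cV[R]_d})
    (gaussX : gaussian_rv X m C) :
  gauss_grad_integral m_ C_ i j =
    Z *: \sum_(J : {set 'I_beta})
      (-1) ^+ (beta - #|J|) *:
      contract_even (tensor_mx (fun b => invmx (C_ (j b))))
        (perm_modes (sigma_modes J)
          (tensor_cast (card_modes J)
            (tensor_mul (tensor_vec (fun a : 'I_#|J| => m_ (j (enum_val a))))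
                  (tensor_moment X (beta - #|J|)))))
  /\
  forall (N : nat) (y : 'I_N -> 'cV[R]_d) (w : 'I_N -> R) (Csqrt : 'M[R]_d),
    (0 < N)%N -> gauss_hermite beta y w -> cholesky_factor Csqrt C ->
    gauss_grad_integral m_ C_ i j =
      (Z * pi `^ (- (d%:R / 2))) *: \sum_(k < N) w k *:
        tensor_vec (fun b => invmx (C_ (j b)) *m
          (m_ (j b) - (Num.sqrt 2 *: (Csqrt *m y k) + m))).
Proof.
split; first exact: gauss_grad_integral_moments.
move=> N y w A _ ghw cholA; apply/ffunP => k.
rewrite (gauss_grad_integralE spdC_ productE).
rewrite (gauss_hermite_prod_affine (f := fun b x =>
    (invmx (C_ (j b)) *m (m_ (j b) - x)) (k b) 0) m Z cholA ghw); last first.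
  by move=> b; exact: (affine_form_grad_factor m_ C_ j b (k b)).
rewrite ffunE sum_ffunE.
apply: (congr1 (fun t => Z * pi `^ (- (d%:R / 2)) * t)).
by apply: eq_bigr => n _; rewrite !ffunE.
Qed.
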